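(* Let $G$ be an inconsistently oriented cycle graph on $n\ge 3$ vertices, let $M$ be the maximum of the finite weights of its $n$ edges, and let $d$ be its shortest path function. Let $K$ be a minimal source dominating set of $P(G)$. If $K=\{k_1,k_2\}$ has two elements, and $s_1,s_2$ are the sink vertices of $G$, then $H_1(\mathfrak{D}_\delta(G))$ is generated by one nontrivial class (it is one-dimensional) for all $\delta$ with $$M\ \le\ \delta\ <\ \max\{d(k_1,s_1),d(k_1,s_2),d(k_2,s_1),d(k_2,s_2)\}.$$
   Context: A network $G=(X,\omega)$ is a finite vertex set $X$ with $\omega:X\times X\to[0,\infty]$. The weight of a path $(x_0,\dots,x_m)$ is $\sum_i\omega(x_i,x_{i+1})$ ($0$ for a constant path), $d(x,y)$ is the infimum of the weights of paths from $x$ to $y$, and $P(G)=(X,d)$ is the path completion. For finite real $\delta\ge0$, $\mathfrak{D}_\delta(G)$ is the simplicial complex on $X$ whose simplices are the nonempty $\sigma\subseteq X$ for which there is $y\in X$ with $d(y,x)\le\delta$ for all $x\in\sigma$. A cycle graph is a network on $\mathbb{Z}/n\mathbb{Z}$ whose underlying undirected graph is the $n$-cycle with each edge given one orientation: for each $i$ exactly one of $\omega(i,i+1),\omega(i+1,i)$ is finite, and $\omega(i,j)=\infty$ for all other pairs $i\ne j$. It is inconsistently oriented if its edges are not all oriented in the same direction around the cycle. A source (sink) is a vertex both of whose incident edges point outward (inward). A source dominating set of $P(G)$ is a set $K$ of vertices such that every vertex $x$ satisfies $d(k,x)<\infty$ for some $k\in K$; it is minimal if no strict subset is source dominating. Homology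 has real coefficients. *)

(* Defs.v *)
From HB Require Import structures.
From mathcomp Require Import all_boot all_order all_algebra.
From mathcomp Require Import reals constructive_ereal ereal classical_sets.

Set Implicit Arguments.
Unset Strict Implicit.
Unset Printing Implicit Defensive.

Import Order.TTheory GRing.Theory Num.Theory.

Local Open Scope ring_scope.
Local Open Scope quotient_scope.

Section QuotientSpace.
Variables (F : fieldType) (V : vectType F) (W : {vspace V}).

Definition quot_space : Type := Quotient.quot (pred_of_vspace W : zmodClosed V).

HB.instance Definition _ := GRing.Zmodule.on quot_space.
HB.instance Definition _ := Quotient.on quot_space.
HB.instance Definition _ := ZmodQuotient.on quot_space.

Definition quot_scale (a : F) (u : quot_space) : quot_space :=
  \pi_quot_space (a *: repr u).

Lemma quot_piE (u v : V) :
  (\pi_quot_space u == \pi_quot_space v) = (u - v \in W).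
Proof. by rewrite -Quotient.idealrBE. Qed.

Lemma quot_scale_pi (a : F) (u : V) :
  quot_scale a (\pi_quot_space u) = \pi_quot_space (a *: u).
Proof.
apply/eqP; rewrite quot_piE -scalerBr; apply: memvZ.
by rewrite -quot_piE reprK.
Qed.

Fact quot_scaleA (a b : F) (u : quot_space) :
  quot_scale a (quot_scale b u) = quot_scale (a * b) u.
Proof. by rewrite -[u]reprK (quot_scale_pi b) !quot_scale_pi scalerA. Qed.

Fact quot_scale1 : left_id 1 quot_scale.
Proof. by move=> u; rewrite -[u]reprK quot_scale_pi scale1r. Qed.

Fact quot_scaleDr : right_distributive quot_scale +%R.
Proof.
move=> a u v; rewrite -[u]reprK -[v]reprK.
by rewrite -pi_addr !quot_scale_pi scalerDr pi_addr.
Qed.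

Fact quot_scaleDl (u : quot_space) :
  {morph quot_scale^~ u : a b / a + b}.
Proof.
by move=> a b; rewrite -[u]reprK !quot_scale_pi scalerDl pi_addr.
Qed.

HB.instance Definition _ := GRing.Zmodule_isLmodule.Build F quot_space
  quot_scaleA quot_scale1 quot_scaleDr quot_scaleDl.

End QuotientSpace.

(* A complex on the vertex type T is given by its set of simplices; the order
   of T orients every simplex. *)
Section SimplicialHomology.
Variables (R : fieldType) (disp : Order.disp_t) (T : finOrderType disp).

Definition chain : vectType R := {ffun {set T} -> R^o}.

Definition simplex_chain (s : {set T}) : chain := [ffun t => (t == s)%:R].

(* A vertex has boundary 0: the complex is not augmented. *)
Definition face_sum (s : {set T}) : chain :=
  if (1 < #|s|)%N then
    \sum_(x in s)
      (-1) ^+ #|[set y in s | (y < x)%O]| *: simplex_chain (s :\ x)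
  else 0.

Definition boundary_fun (c : chain) : chain := \sum_s c s *: face_sum s.

Fact boundary_fun_linear : linear boundary_fun.
Proof.
move=> a c c'; rewrite /boundary_fun scaler_sumr -big_split /=.
by apply: eq_bigr => s _; rewrite !ffunE scalerDl scalerA.
Qed.

HB.instance Definition _ :=
  GRing.isLinear.Build R chain chain _ boundary_fun boundary_fun_linear.

Definition boundary : 'End(chain) := linfun boundary_fun.

Variable K : {set {set T}}.

Definition chains (k : nat) : {vspace chain} :=
  <<[seq simplex_chain s | s in [set s in K | #|s| == k.+1]]>>%VS.

Definition cycles (k : nat) : {vspace chain} :=
  (chains k :&: lker boundary)%VS.

Definition boundaries (k : nat) : {vspace chain} :=
  (boundary @: chains k.+1)%VS.

Definition homology (k : nat) : lmodType R :=
  quot_space (linfun (vsval : subvs_of (cycles k) -> chain)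
              @^-1: boundaries k)%VS.

End SimplicialHomology.

Local Open Scope ereal_scope.

Section Networks.
Variables (R : realType) (T : finType).
Implicit Types (w d : T -> T -> \bar R).

Definition is_network w := forall x y, 0 <= w x y.

(* weight of the path x :: p *)
Definition path_weight w (x : T) (p : seq T) : \bar R :=
  \sum_(e <- zip (x :: p) p) w e.1 e.2.

Definition path_completion w (x y : T) : \bar R :=
  ereal_inf [set path_weight w x p | p in [set p | last x p = y]]%classic.

Definition dowker w (delta : R) : {set {set T}} :=
  [set s | (s != finset.set0) &&
     [exists y, [forall x in s, path_completion w y x <= delta%:E]]].

(* d is meant to be a path completion. *)
Definition source_dominating d (K : {set T}) :=
  forall x, exists2 k, k \in K & d k x < +oo.

Definition minimal_source_dominating d (K : {set T}) :=
  source_dominating d K /\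
  forall K' : {set T}, K' \proper K -> ~ source_dominating d K'.

End Networks.

Section CycleGraphs.
Variables (R : realType) (n : nat).
Implicit Types (w : 'I_n -> 'I_n -> \bar R) (i j v : 'I_n).

(* i ranges over Z/n, with ordS i = i + 1 and ord_pred i = i - 1; w i i is
   unconstrained. *)
Definition cycle_graph w :=
  [/\ is_network w,
      forall i, (w i (ordS i) < +oo) (+) (w (ordS i) i < +oo) &
      forall i j, i != j -> j != ordS i -> i != ordS j -> w i j = +oo].

Definition inconsistently_oriented w :=
  ~ ((forall i, w i (ordS i) < +oo) \/ (forall i, w (ordS i) i < +oo)).

(* weight of the edge between i and i + 1, in whichever direction it is
   oriented; maximising w over all finite entries would also count w i i *)
Definition edge_weight w i : \bar R :=
  if w i (ordS i) < +oo then w i (ordS i) else w (ordS i) i.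

Definition max_edge_weight w : \bar R :=
  \big[Order.max/-oo]_(i < n) edge_weight w i.

Definition sink w v : bool :=
  (w (ordS v) v < +oo) && (w (ord_pred v) v < +oo).

End CycleGraphs.

(* Main.v *)
(* Whenever x lies in the delta-ball of y, coning the vertices of a path inside
   that ball off at y shows that the edge yx is homologous to a sum of edges of
   the n-cycle.  As delta >= M, these edges are simplices, so every 1-cycle is
   homologous to a multiple of the fundamental cycle.

   For nontriviality let d(k,s) > delta with k in K and s a sink.  By minimality
   of K each neighbour of s is reached by exactly one element of K, and k cannot
   miss both neighbours, since the other element would then reach every vertex.
   So k reaches exactly one neighbour p of s.  Let A be the set of vertices
   reaching p.  A ball containing s is not centred at k, hence its vertices other
   than s lie all in A or all outside A.  The signed number of times a 1-chain
   enters s from A is therefore a cocycle, and it is 1 or -1 on the fundamental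
   cycle. *)
Require Import Defs.
From HB Require Import structures.
From mathcomp Require Import all_boot all_order all_algebra.
From mathcomp Require Import reals constructive_ereal ereal.
Import Order.TTheory GRing.Theory Num.Theory.

Set Implicit Arguments.
Unset Strict Implicit.
Unset Printing Implicit Defensive.
Local Open Scope ring_scope.

(** * Simplicial 1-chains *)

Section Chains.
Variables (F : fieldType) (disp : Order.disp_t) (T : finOrderType disp).
Implicit Types (a b c x y z : T) (K : {set {set T}}) (A : {set T}).

(** The oriented edge from [a] to [b]: antisymmetric, and zero when [a = b], so that later formulas
    need no case split on the order of [T]. *)
Definition edge_chain a b : chain F T :=
  if (a < b)%O then simplex_chain F [set a; b]
  else if (b < a)%O then - simplex_chain F [set a; b] else 0.

Lemma edge_chainC a b : edge_chain a b = - edge_chain b a.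
Proof.
by rewrite /edge_chain setUC; case: ltgtP => _; rewrite ?opprK ?oppr0.
Qed.

Lemma edge_chainxx a : edge_chain a a = 0.
Proof. by rewrite /edge_chain ltxx. Qed.

Lemma edge_chain_lt a b : (a < b)%O -> edge_chain a b = simplex_chain F [set a; b].
Proof. by rewrite /edge_chain => ->. Qed.

Lemma boundary_simplex s : boundary F T (simplex_chain F s) = face_sum F s.
Proof.
rewrite lfunE /= /boundary_fun (bigD1 s) //= ffunE eqxx scale1r big1 ?addr0 //.
by move=> t nts; rewrite ffunE (negPf nts) scale0r.
Qed.

Lemma face_sum2 a b : (a < b)%O ->
  face_sum F [set a; b] = simplex_chain F [set b] - simplex_chain F [set a].
Proof.
move=> ab; have nab := lt_eqF ab.
rewrite /face_sum cards2 nab /= big_setU1 ?inE ?nab //= big_set1.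
have -> : [set y in [set a; b] | (y < a)%O] = set0.
  by apply/setP=> y; rewrite !inE; case: eqVneq => [->|_] /=; rewrite ?ltxx //;
    case: eqVneq => [->|_] //=; rewrite ltNge ltW.
have -> : [set y in [set a; b] | (y < b)%O] = [set a].
  by apply/setP=> y; rewrite !inE; case: eqVneq => [->|_] /=; rewrite ?ab //;
    case: eqVneq => [->|_] //=; rewrite ltxx.
rewrite cards0 cards1 expr0 scale1r expr1 scaleN1r; congr (simplex_chain _ _ - simplex_chain _ _);
  apply/setP=> y; rewrite !inE; first by case: eqVneq => [->|_] //=; rewrite nab.
by case: eqVneq => [->|_] /=; rewrite ?orbF // eq_sym nab.
Qed.

Lemma face_sum3 a b c : (a < b)%O -> (b < c)%O ->
  face_sum F [set a; b; c] = edge_chain a b + edge_chain b c + edge_chain c a.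
Proof.
move=> ab bc; have ac := lt_trans ab bc.
have [nab nbc nac] : [/\ (a == b) = false, (b == c) = false & (a == c) = false].
  by rewrite !lt_eqF.
have [nba ncb nca] : [/\ (b == a) = false, (c == b) = false & (c == a) = false].
  by rewrite !gt_eqF.
have [gba gcb gca] : [/\ (b < a)%O = false, (c < b)%O = false & (c < a)%O = false].
  by rewrite (lt_gtF ab) (lt_gtF bc) (lt_gtF ac).
have nE := (nab, nbc, nac, nba, ncb, nca, ab, bc, ac, gba, gcb, gca).
have setE : [set a; b; c] = a |: (b |: [set c]) by rewrite setUA.
rewrite /face_sum setE !cardsU1 cards1 !inE !nE /= !big_setU1 ?inE ?nE //= big_set1.
rewrite -setE.
have -> : [set y in [set a; b; c] | (y < a)%O] = set0.
  apply/setP=> y; rewrite !inE.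
  by do 3?[case: eqVneq => [->|_] /=; rewrite ?(nE, ltxx) //].
have -> : [set y in [set a; b; c] | (y < b)%O] = [set a].
  apply/setP=> y; rewrite !inE.
  by do 3?[case: eqVneq => [->|_] /=; rewrite ?(nE, ltxx) //].
have -> : [set y in [set a; b; c] | (y < c)%O] = [set a; b].
  apply/setP=> y; rewrite !inE.
  by do 3?[case: eqVneq => [->|_] /=; rewrite ?(nE, ltxx) //].
have -> : [set a; b; c] :\ a = [set b; c].
  apply/setP=> y; rewrite !inE.
  by do 3?[case: eqVneq => [->|_] /=; rewrite ?(nE, ltxx) //].
have -> : [set a; b; c] :\ b = [set a; c].
  apply/setP=> y; rewrite !inE.
  by do 3?[case: eqVneq => [->|_] /=; rewrite ?(nE, ltxx) //].
have -> : [set a; b; c] :\ c = [set a; b].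
  apply/setP=> y; rewrite !inE.
  by do 3?[case: eqVneq => [->|_] /=; rewrite ?(nE, ltxx, orbF) //].
rewrite cards0 cards1 cards2 nab /= expr0 scale1r expr1 scaleN1r sqrrN expr1n scale1r.
rewrite (edge_chainC c a) !edge_chain_lt //.
by rewrite addrA addrC addrA.
Qed.

Lemma boundary_edge a b :
  boundary F T (edge_chain a b) = simplex_chain F [set b] - simplex_chain F [set a].
Proof.
have lt_case x y : (x < y)%O -> boundary F T (edge_chain x y) =
    simplex_chain F [set y] - simplex_chain F [set x].
  by move=> xy; rewrite edge_chain_lt // boundary_simplex face_sum2.
case: (ltgtP a b) => [/lt_case // | /lt_case ba | ->].
  by rewrite edge_chainC linearN /= ba opprB.
by rewrite edge_chainxx linear0 subrr.
Qed.

Lemma cards2_lt (s : {set T}) : #|s| = 2 -> exists a b, (a < b)%O /\ s = [set a; b].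
Proof.
move/eqP/cards2P=> [a [b [nab ->]]].
by case: (ltgtP a b) nab => // lt _; [exists a, b | exists b, a; rewrite setUC].
Qed.

Lemma cards3_lt (s : {set T}) : #|s| = 3 ->
  exists a b c, [/\ (a < b)%O, (b < c)%O & s = [set a; b; c]].
Proof.
move=> s3; have /card_gt0P[x xs] : (0 < #|s|)%N by rewrite s3.
have : #|s :\ x| = 2 by move: s3; rewrite (cardsD1 x) xs => -[].
move/cards2_lt=> [a [b [ab sE]]].
have xE : x \notin [set a; b] by rewrite -sE !inE eqxx.
rewrite -(setD1K xs) sE; move: xE; rewrite !inE => /norP[xa xb].
case: (ltgtP x a) xa => // [xa | ax] _; first by exists x, a, b; rewrite setUA.
case: (ltgtP x b) xb => // [xb | bx] _; last by exists a, b, x; rewrite setUC.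
by exists a, x, b; split=> //; rewrite setUA (setUC [set x]).
Qed.

(** Triangles span the 2-chains and can be listed in increasing order. With [W] a kernel, this tests
    whether a linear map kills all boundaries. *)
Lemma boundaries1_le K (W : {vspace chain F T}) :
  (forall a b c, (a < b)%O -> (b < c)%O -> [set a; b; c] \in K ->
     edge_chain a b + edge_chain b c + edge_chain c a \in W) ->
  (boundaries F K 1 <= W)%VS.
Proof.
move=> HW; rewrite /boundaries /chains limg_span; apply/span_subvP=> u.
case/mapP=> v /imageP[s]; rewrite inE => /andP[sK /eqP/cards3_lt] [a [b [c [ab bc sE]]]].
by move=> -> ->; rewrite boundary_simplex sE face_sum3 // HW // -sE.
Qed.

(** Permuting the vertices changes the sum at most by a sign, and a repeated vertex makes it vanish.
    Repetitions are allowed because coning at [y] meets edges that contain [y]. *)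
Lemma triangle_boundary K a b c : [set a; b; c] \in K ->
  edge_chain a b + edge_chain b c + edge_chain c a \in boundaries F K 1.
Proof.
have sorted3 x y z : (x < y)%O -> (y < z)%O -> [set x; y; z] \in K ->
    edge_chain x y + edge_chain y z + edge_chain z x \in boundaries F K 1.
  move=> xy yz xyzK; rewrite -face_sum3 // -boundary_simplex.
  apply: memv_img; apply: memv_span; apply: image_f; rewrite inE xyzK /=.
  rewrite -setUA cardsU1 cards2 !inE (lt_eqF xy) (lt_eqF yz) /=.
  by rewrite (lt_eqF (lt_trans xy yz)).
have rot x y z : edge_chain x y + edge_chain y z + edge_chain z x
    = edge_chain y z + edge_chain z x + edge_chain x y.
  by rewrite -addrA addrC.
have flip x y z : edge_chain x y + edge_chain y z + edge_chain z x
    = - (edge_chain y x + edge_chain x z + edge_chain z y).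
  by rewrite !opprD -!edge_chainC addrAC.
have rotS x y z : [set x; y; z] = [set y; z; x] by rewrite -setUA setUC.
have flipS x y z : [set x; y; z] = [set y; x; z] by rewrite (setUC [set x]).
have [->|nab] := eqVneq a b.
  by rewrite edge_chainxx add0r edge_chainC addNr mem0v.
have [->|nbc] := eqVneq b c.
  by rewrite edge_chainxx addr0 edge_chainC addNr mem0v.
have [->|nac] := eqVneq a c.
  by rewrite edge_chainxx addr0 edge_chainC addNr mem0v.
move=> abcK; case: (ltgtP a b) nab => // [ab|ba] _; case: (ltgtP b c) nbc => // [bc|cb] _.
- exact: sorted3.
- case: (ltgtP a c) nac => // [ac|ca] _.
    rewrite flip memvN rot. apply: sorted3 => //. by rewrite setUAC.
  by rewrite rot rot; apply: sorted3 => //; rewrite rotS.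
- case: (ltgtP a c) nac => // [ac|ca] _.
    by rewrite flip memvN; apply: sorted3 => //; rewrite flipS.
  by rewrite rot; apply: sorted3 => //; rewrite -rotS.
- by rewrite flip memvN rot rot; apply: sorted3 => //; rewrite rotS flipS.
Qed.

(** * The crossing cocycle at a vertex *)

Section Crossing.
Variables (A : {set T}) (s : T).
Hypothesis sA : s \notin A.

(* As an edge chain, ab counts 1 if b = s and a is in A, and -1 if a = s and b
   is in A; the sign is needed because a simplex is oriented by the order of T. *)
Definition crossing (c : chain F T) : F^o :=
  \sum_(x in A) (if (x < s)%O then 1 else - 1) * c [set x; s].

Fact crossing_linear : linear crossing.
Proof.
move=> k c c'; rewrite /crossing scaler_sumr -big_split /=.
by apply: eq_bigr => x _; rewrite !ffunE mulrDr /GRing.scale /= mulrCA.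
Qed.

HB.instance Definition _ := GRing.isLinear.Build F (chain F T) F^o _ crossing crossing_linear.

Lemma crossing_simplex_out (t : {set T}) : s \notin t -> crossing (simplex_chain F t) = 0.
Proof.
move=> st; apply: big1 => x _; rewrite ffunE; case: eqP => [tE|_]; last by rewrite mulr0.
by rewrite -tE !inE eqxx orbT in st.
Qed.

Lemma crossing_edge_to a : a != s -> crossing (edge_chain a s) = (a \in A)%:R.
Proof.
move=> nas.
have crossE : crossing (simplex_chain F [set a; s]) =
    (if (a < s)%O then 1 else - 1) * (a \in A)%:R.
  rewrite /crossing (eq_bigr (fun x => (if (x < s)%O then 1 else - 1) * (x == a)%:R)).
    have [aA|aA] := boolP (a \in A).
      by rewrite (bigD1 a) //= eqxx big1 ?addr0 // => x /andP[_ /negPf ->]; rewrite mulr0.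
    by rewrite mulr0 big1 // => x xA; case: eqP xA => [->|_ _]; rewrite ?(negPf aA) ?mulr0.
  move=> x xA; rewrite ffunE; congr (_ * (nat_of_bool _)%:R).
  apply/eqP/eqP => [/setP/(_ x) | -> //]; rewrite !inE eqxx /=.
  have /negPf -> : x != s by apply: contraNneq sA => <-.
  by rewrite orbF => /esym/eqP.
rewrite /edge_chain; case: (ltgtP a s) nas crossE => // [lt_as|gt_as] _ crossE.
  by rewrite crossE mul1r.
by rewrite linearN /= crossE mulN1r opprK.
Qed.

Lemma crossing_edge a b :
  crossing (edge_chain a b) = ((b == s) && (a \in A))%:R - ((a == s) && (b \in A))%:R.
Proof.
have [->|nbs] := eqVneq b s.
  have [->|nas] := eqVneq a s; first by rewrite edge_chainxx linear0 subrr.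
  by rewrite crossing_edge_to // subr0.
have [->|nas] := eqVneq a s.
  by rewrite edge_chainC linearN /= crossing_edge_to // sub0r.
have out : s \notin [set a; b] by rewrite !inE !(eq_sym s) (negPf nas).
rewrite /= subrr /edge_chain; do 2?case: ifP => _; last exact: linear0.
  exact: crossing_simplex_out.
by rewrite linearN /= crossing_simplex_out // oppr0.
Qed.

(** Only triangles through [s] matter. There the edge entering [s] and the edge leaving it count
    with opposite signs, and by hypothesis their other ends agree about [A]. *)
Lemma crossing_boundary K u :
  (forall a b, [set a; b; s] \in K -> a != s -> b != s -> (a \in A) = (b \in A)) ->
  u \in boundaries F K 1 -> crossing u = 0.
Proof.
move=> HA uB; suff : u \in lker (linfun crossing) by rewrite memv_ker lfunE => /eqP.
apply: (subvP _ u uB); apply: boundaries1_le => a b c ab bc abcK.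
rewrite memv_ker lfunE /= !linearD /= !crossing_edge.
have neq x y : (x < y)%O -> (x == y) = false /\ (y == x) = false.
  by move=> xy; rewrite lt_eqF ?gt_eqF.
have [[ab1 ab2] [bc1 bc2] [ac1 ac2]] := And3 (neq _ _ ab) (neq _ _ bc) (neq _ _ (lt_trans ab bc)).
have [aE|nas] := eqVneq a s.
  rewrite -aE ab2 ac2 /= subr0 sub0r.
  rewrite (HA b c) ?subr0 ?addr0 ?addNr // -aE ?ab2 ?ac2 //.
  by rewrite setUC setUA.
have [bE|nbs] := eqVneq b s.
  rewrite -bE bc2 /= ?subr0 ?sub0r ?addr0.
  rewrite (HA a c) ?subrr // -bE ?bc2 // ?ab1 //.
  by rewrite setUAC.
have [cE|ncs] := eqVneq c s; last by rewrite /= !subrr !addr0.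
rewrite /= !subr0 add0r sub0r (HA a b) ?subrr //.
by rewrite -cE.
Qed.

End Crossing.

End Chains.

(** * Paths in oriented cycles *)

Local Open Scope ereal_scope.

Section OrientedCycle.
Variables (T : finType) (e : rel T) (sg tu : T -> T).
Hypotheses (sgK : cancel sg tu) (tuK : cancel tu sg).
Hypothesis e_adj : forall x y, e x y -> y = sg x \/ y = tu x.
Hypothesis e_anti : forall x y, e x y -> ~~ e y x.

(** [sg] and [tu] are the two directions round the cycle, left abstract so that the lemmas apply
    with them exchanged. A run has [j + 1] consecutive edges directed towards [s], the last one
    leaving [sg s]. *)
Definition run_to (s : T) (j : nat) : Prop :=
  forall i, (i <= j)%N -> e (iter i.+1 sg s) (iter i sg s).

Lemma run_to_connect s j i i' : run_to s j -> (i' <= i)%N -> (i <= j.+1)%N ->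
  connect e (iter i sg s) (iter i' sg s).
Proof.
move=> run; elim: i => [|i IH]; first by rewrite leqn0 => /eqP ->.
rewrite leq_eqVlt => /predU1P[-> // | lt_i' lt_i].
by apply: connect_trans (IH lt_i' (ltnW lt_i)); apply/connect1/run.
Qed.

(** Induction along the path: its first edge cannot come from the side of [s], as the run holds that
    edge in the opposite direction, so it lengthens the run by one. *)
Lemma connect_run s x : e (sg s) s -> connect e x (sg s) ->
  exists2 j, x = iter j.+1 sg s & run_to s j.
Proof.
move=> es /connectP[p]; elim: p x => [|y p IH] x /=.
  by move=> _ <-; exists 0%N => // i; rewrite leqn0 => /eqP ->.
case/andP=> exy pp lp; have [j yE run] := IH _ pp lp.
case: (e_adj exy) => [yx | yx].
  have xE : x = iter j sg s by apply: (can_inj sgK); rewrite -yx yE.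
  have : e y x by rewrite yE [X in e _ X]xE; apply: run.
  by move/e_anti; rewrite exy.
exists j.+1; first by rewrite -yE yx tuK.
move=> i; rewrite leq_eqVlt => /predU1P[-> | /run //].
by rewrite (iterS j.+1) -yE yx tuK -yx.
Qed.

(** Both vertices lie on runs from the same side, and the longer run passes through the start of the
    shorter one. *)
Lemma connect_total s x y : e (sg s) s ->
  connect e x (sg s) -> connect e y (sg s) -> connect e x y || connect e y x.
Proof.
move=> es /(connect_run es)[i -> ri] /(connect_run es)[j -> rj].
case: (leqP i j) => [le_ij | /ltnW le_ji].
  by rewrite (@run_to_connect s j j.+1 i.+1) ?orbT.
by rewrite (@run_to_connect s i i.+1 j.+1).
Qed.

(** The edge from [z] uses up one neighbour of [y], so a path from [y] can only follow the run
    towards [s], and it stops if it arrives at the sink [s]. *)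
Lemma connect_forward s z y a : e (sg s) s -> e (tu s) s -> e z y ->
  connect e y (sg s) -> connect e y a -> a = s \/ connect e a (sg s).
Proof.
move=> es es' ezy yp /connectP[p]; elim: p z y ezy yp => [|b p IH] z y ezy yp /=.
  by move=> _ ->; right.
case/andP=> eyb pp lp.
have [j yE run] := connect_run es yp.
have eyj : e y (iter j sg s) by rewrite yE; apply: run.
(* Otherwise [b] is [sg y], edges lead from [y] to both its neighbours, and [z] can be neither. *)
have bE : b = iter j sg s.
  have jE : iter j sg s = tu y by rewrite yE iterS sgK.
  case: (e_adj eyb) => bE; last by rewrite bE jE.
  case: (e_adj ezy) => yz.
    by have := e_anti eyj; rewrite jE yz sgK -yz ezy.
  by have := e_anti eyb; rewrite bE yz tuK -yz ezy.
case: j yE run eyj bE => [|j] yE run eyj bE.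
  left; move: pp lp; rewrite bE /=; case: p {IH} => [|c p] //= /andP[esc _].
  by have := e_anti esc; case: (e_adj esc) => ->; rewrite ?es ?es'.
apply: IH eyb _ pp lp; rewrite bE.
exact: (@run_to_connect s j.+1 j.+1 1).
Qed.

End OrientedCycle.

(** The runs from [u] down to [s] on the two sides together cover the cycle. *)
Lemma connect_cover (T : finType) (e : rel T) (sg tu : T -> T) (s u x : T) :
  cancel sg tu -> cancel tu sg ->
  (forall x y, e x y -> y = sg x \/ y = tu x) ->
  (forall x y, e x y -> ~~ e y x) ->
  (forall y, exists i, y = iter i sg s) ->
  e (sg s) s -> e (tu s) s ->
  connect e u (sg s) -> connect e u (tu s) -> connect e u x.
Proof.
move=> sgK tuK adj anti orb es es' us us'.
have [j uE run] := connect_run sgK tuK adj anti es us.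
have adj' a b : e a b -> b = tu a \/ b = sg a by move/adj; tauto.
have [j' uE' run'] := connect_run tuK sgK adj' anti es' us'.
have [t ->] := orb x.
(* The walk by [sg] from [s] climbs the first run up to [u], descends the second one to [s], and
   starts again. *)
suff [[i le_i ->] | [i le_i ->]] : (exists2 i, (i <= j.+1)%N & iter t sg s = iter i sg s)
   \/ (exists2 i, (i <= j'.+1)%N & iter t sg s = iter i tu s).
- by rewrite uE; apply: (run_to_connect run).
- by rewrite uE'; apply: (run_to_connect run').
elim: t => [|t [[i le_i tE] | [i le_i tE]]]; first by left; exists 0%N.
- move: le_i; rewrite leq_eqVlt => /predU1P[iE | lt_i]; last first.
    by left; exists i.+1; rewrite // !iterS tE.
  right; exists j'; first exact: leqnSn.
  by rewrite iterS tE iE -uE uE' iterS tuK.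
- case: i le_i tE => [|i] lt_i tE; first by left; exists 1%N; rewrite // iterS tE.
  by right; exists i; rewrite ?(ltnW lt_i) // iterS tE iterS tuK.
Qed.

(** * Shortest path distances and reachability *)

Section Distance.
Variables (R : realType) (T : finType) (w : T -> T -> \bar R).
Hypothesis w_ge0 : is_network w.
Let d := path_completion w.

(** Loops are left out: [w x x] may be finite, and a loop would break the antisymmetry of the edge
    relation. *)
Definition finite_edge : rel T := fun x y => (x != y) && (w x y < +oo).

Lemma path_weight_cons x y p :
  path_weight w x (y :: p) = w x y + path_weight w y p.
Proof. by rewrite /path_weight /= big_cons. Qed.

Lemma path_weight_ge0 x p : 0 <= path_weight w x p.
Proof. by apply: sume_ge0 => i _; apply: w_ge0. Qed.

Lemma path_completion_le x p : d x (last x p) <= path_weight w x p.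
Proof. by apply: ereal_inf_lbound; exists p. Qed.

Lemma path_completion_refl_le x (delta : R) : (0 <= delta)%R -> d x x <= delta%:E.
Proof.
move=> d0; apply: le_trans (path_completion_le x [::]) _.
by rewrite /path_weight /= big_nil lee_fin.
Qed.

Lemma path_completion_le_edge x y : d x y <= w x y.
Proof.
apply: le_trans (path_completion_le x [:: y]) _.
by rewrite path_weight_cons /path_weight /= big_nil adde0.
Qed.

(** If the infimum is below [+oo], some path has finite weight; weights being nonnegative, all its
    edges are finite, and its loops can be skipped. *)
Lemma connect_path_completion x y : connect finite_edge x y = (d x y < +oo).
Proof.
apply/idP/idP.
  case/connectP=> p pp ->; apply: le_lt_trans (path_completion_le x p) _.
  elim: p x pp => [|z p IH] x /=; first by rewrite /path_weight /= big_nil ltry.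
  case/andP=> /andP[_ exz] pp; rewrite path_weight_cons.
  by apply: lte_add_pinfty => //; apply: IH.
case/ereal_inf_lt=> _ [p /= <- <-]; elim: p x => [|z p IH] x //=.
rewrite path_weight_cons => fin.
have fin1 : w x z < +oo by apply: le_lt_trans fin; rewrite leeDl // path_weight_ge0.
have fin2 : path_weight w z p < +oo by apply: le_lt_trans fin; rewrite leeDr // w_ge0.
have [->|nxz] := eqVneq x z; first exact: IH.
by apply: connect_trans (IH _ fin2); apply: connect1; rewrite /finite_edge nxz.
Qed.

Definition ball_edge (delta : \bar R) y : rel T :=
  fun a b => finite_edge a b && (d y b <= delta).

(* The infimum defining [d y x] need not be shown to be attained: a path from y
   to x that leaves the delta-ball of y weighs at least the minimum of [d y]
   over the finitely many vertices outside that ball. *)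
Lemma connect_ball (delta : R) y x :
  d y x <= delta%:E -> connect (ball_edge delta%:E y) y x.
Proof.
move=> dyx; apply: contraT => nc.
(* If no vertex lies outside the ball, [m] is the default [+oo], still above [delta]. *)
pose m := \big[Order.min/+oo]_(v | ~~ (d y v <= delta%:E)) d y v.
have lt_m : delta%:E < m.
  by apply/bigmin_gtP; split=> [|v]; rewrite ?ltry // -ltNge.
suff : m <= d y x by rewrite leNgt (le_lt_trans dyx).
apply: le_ereal_inf_tmp => _ [p /= lp <-].
(* [q] is the part of the path already walked, its end still connected to [y] within the ball; [r]
   is the rest. *)
suff H q r : connect (ball_edge delta%:E y) y (last y q) -> last y (q ++ r) = x ->
    m <= path_weight w y q + path_weight w (last y q) r.
  by have := H [::] p (connect0 _ _) lp; rewrite {1}/path_weight /= big_nil add0e.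
elim: r q => [|z r IH] q cq; first by rewrite cats0 => lq; rewrite -lq cq in nc.
have wcat : path_weight w y (rcons q z) = path_weight w y q + w (last y q) z.
  elim: (q) (y) => [|a q' IHq] b /=; rewrite !path_weight_cons.
    by rewrite /path_weight /= big_nil adde0 add0e.
  by rewrite IHq addeA.
rewrite path_weight_cons addeA -wcat => lz.
have := IH (rcons q z); rewrite last_rcons cat_rcons => IH'.
have [inf | fin] := leP +oo (w (last y q) z).
  suff -> : path_weight w y (rcons q z) + path_weight w z r = +oo by rewrite leey.
  move: inf; rewrite wcat leye_eq => /eqP ->.
  by rewrite addey ?addye // gt_eqF // (lt_le_trans _ (path_weight_ge0 _ _)) ?ltNy0.
have [in_ball | out] := boolP (d y z <= delta%:E).
  apply: IH' => //; have [<-//|nz] := eqVneq (last y q) z.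
  by apply: connect_trans cq (connect1 _); rewrite /ball_edge /finite_edge nz fin.
have le_m : m <= d y z by apply: bigmin_le_cond.
apply: le_trans le_m _.
apply: le_trans (_ : path_weight w y (rcons q z) <= _).
  by rewrite -{1}(last_rcons y q z) path_completion_le.
by rewrite leeDl // path_weight_ge0.
Qed.

End Distance.

(** * Separating the two sides of a sink *)

Section Separation.
Variables (R : realType) (T : finType) (w : T -> T -> \bar R).
Hypothesis w_ge0 : is_network w.
Variables k1 k2 : T.
Hypothesis k1Dk2 : k1 != k2.
Hypothesis min_k : minimal_source_dominating (path_completion w) [set k1; k2].
Let d := path_completion w.
Let e := finite_edge w.

Lemma not_dominating1 k : k \in [set k1; k2] -> ~ (forall x, connect e k x).
Proof.
move=> kK dom; case: min_k => _ /(_ [set k]); apply.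
  by rewrite properEcard sub1set kK cards1 cards2 k1Dk2.
by move=> x; exists k; rewrite ?inE // -connect_path_completion.
Qed.

Lemma dominatedP x : connect e k1 x \/ connect e k2 x.
Proof.
case: min_k => /(_ x)[k kK dk] _.
by move: kK dk; rewrite !inE -connect_path_completion // => /orP[] /eqP ->; auto.
Qed.

(** If one of the two reached the other, it would dominate on its own, against minimality. *)
Lemma dominating_antichain : ~~ connect e k1 k2 && ~~ connect e k2 k1.
Proof.
apply/andP; split; apply/negP => c; [have := @not_dominating1 k1|have := @not_dominating1 k2];
  rewrite !inE eqxx ?orbT => /(_ isT); apply=> x; case: (dominatedP x) => // cx;
  exact: connect_trans c cx.
Qed.

Variables (sg tu : T -> T) (s : T) (delta : R).
Hypotheses (sgK : cancel sg tu) (tuK : cancel tu sg).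
Hypothesis e_adj : forall x y, e x y -> y = sg x \/ y = tu x.
Hypothesis e_anti : forall x y, e x y -> ~~ e y x.
Hypotheses (es : e (sg s) s) (es' : e (tu s) s).
Hypothesis far : delta%:E < d k1 s.
Hypothesis k1_sg : connect e k1 (sg s).
Hypothesis k1_tu : ~~ connect e k1 (tu s).

Let A := [set a | connect e a (sg s)].

(** Two vertices reaching [sg s] are comparable under reachability, whereas [k1] and [k2] are
    not. *)
Lemma k2_notin_side : k2 \notin A.
Proof.
rewrite inE; apply/negP=> k2_sg.
have := connect_total sgK tuK e_adj e_anti es k1_sg k2_sg.
by have /andP[/negPf -> /negPf ->] := dominating_antichain.
Qed.

(** As [y] reaches [a], [a] in [A] puts [y] in [A]. Conversely, from a [y] in [A] with an incoming
    edge, paths only follow its run, so [a] is in [A]. A [y] without incoming edges is [k1] or [k2]: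
    the first is too far from [s], the second outside [A]. *)
Lemma side_ball y a :
  d y s <= delta%:E -> d y a <= delta%:E -> a != s -> (a \in A) = (y \in A).
Proof.
move=> dys dya nas.
have cya : connect e y a.
  by rewrite connect_path_completion // (le_lt_trans dya) ?ltry.
apply/idP/idP; rewrite !inE; first exact: connect_trans.
move=> cyp; have [/existsP[z ezy] | nin] := boolP [exists z, e z y].
  have [aE|//] := connect_forward sgK tuK e_adj e_anti es es' ezy cyp cya.
  by rewrite aE eqxx in nas.
have src x : connect e x y -> x = y.
  case/connectP=> p; elim/last_ind: p => [_ -> //|p z _].
  rewrite rcons_path last_rcons => /andP[_ ez] yz.
  by case/existsP: nin; exists (last x p); rewrite yz.
case: (dominatedP y) => /src yE; first by move: far; rewrite yE ltNge dys.
by case/negP: k2_notin_side; rewrite inE yE.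
Qed.

Lemma separating_set : exists A : {set T},
  [/\ s \notin A, sg s \in A, tu s \notin A &
      forall y a b, d y s <= delta%:E -> d y a <= delta%:E -> d y b <= delta%:E ->
        a != s -> b != s -> (a \in A) = (b \in A)].
Proof.
exists A; split; last first.
- by move=> y a b ys ya yb nas nbs; rewrite (side_ball ys ya) // (side_ball ys yb).
(* [tu s] must be reached by [k2], which would then reach [sg s] as well. *)
- rewrite inE; apply/negP => c; case: (dominatedP (tu s)) => ct.
    by move: k1_tu; rewrite ct.
  by case/negP: k2_notin_side; rewrite inE (connect_trans ct).
- by rewrite inE connect0.
- rewrite inE; apply/negP => /connectP[[|z p] /=].
    by move=> _ sE; case/andP: es; rewrite sE eqxx.
  case/andP=> esz _ _; have := e_anti esz.
  by case: (e_adj esz) => ->; rewrite ?es ?es'.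
Qed.

End Separation.

(** * The separating set in a cycle graph *)

Section CycleNetwork.
Variables (R : realType) (n : nat) (w : 'I_n -> 'I_n -> \bar R).
Hypotheses (n_gt1 : (1 < n)%N) (cyc : cycle_graph w).
Let e := finite_edge w.

Lemma ordS_neq (i : 'I_n) : ordS i != i.
Proof.
apply/eqP=> /(congr1 val) /=; have := ltn_ord i.
rewrite leq_eqVlt => /predU1P[iE | lt_i]; last by rewrite modn_small // => /esym/n_Sn.
by rewrite iE modnn => i0; move: n_gt1; rewrite -iE -i0.
Qed.

Lemma ordS_orbit (i j : 'I_n) : exists k, j = iter k (@ordS n) i.
Proof.
have iterE k : val (iter k (@ordS n) i) = ((i + k) %% n)%N.
  elim: k => [|k IH]; first by rewrite addn0 modn_small.
  by rewrite iterS /= IH -addn1 modnDml addn1 addnS.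
exists (j + (n - i))%N; apply: val_inj; rewrite iterE addnCA subnKC 1?ltnW //.
by rewrite modnDr modn_small.
Qed.

Lemma cycle_edge_adj x y : e x y -> y = ordS x \/ y = ord_pred x.
Proof.
case/andP=> nxy; have [_ _ /(_ x y nxy)] := cyc.
have [->|_] := eqVneq y (ordS x); first by left.
have [->|_ -> //] := eqVneq x (ordS y); first by rewrite ordSK; right.
Qed.

Lemma cycle_edge_anti x y : e x y -> ~~ e y x.
Proof.
move=> exy; have [_ xor _] := cyc.
have adj := cycle_edge_adj exy; case: adj exy => [-> | yE].
  by case/andP=> _; rewrite /e /finite_edge ordS_neq /=; have := xor x; case: (w x _ < _).
have -> : x = ordS y by rewrite yE ord_predK.
case/andP=> _; rewrite /e /finite_edge eq_sym ordS_neq /=.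
by have := xor y; case: (w y _ < _); case: (_ < _).
Qed.

(** Case split on the neighbours of [s] that [k1] reaches. If both, [k1] reaches every vertex; if
    neither, [k2] does. If exactly one, the separation applies, with the two directions exchanged in
    the mirror case. *)
Lemma cycle_separating_set k1 k2 s (delta : R) : k1 != k2 ->
  minimal_source_dominating (path_completion w) [set k1; k2] -> sink w s ->
  delta%:E < path_completion w k1 s ->
  exists A : {set 'I_n},
  [/\ s \notin A, (ordS s \in A) != (ord_pred s \in A) &
      forall y a b, path_completion w y s <= delta%:E ->
        path_completion w y a <= delta%:E -> path_completion w y b <= delta%:E ->
        a != s -> b != s -> (a \in A) = (b \in A)].
Proof.
move=> k12 min_k /andP[es es'] far.
have w0 : is_network w by case: cyc.
have {}es : e (ordS s) s by rewrite /e /finite_edge ordS_neq.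
have {}es' : e (ord_pred s) s.
  by rewrite /e /finite_edge es' -{2}[s]ord_predK eq_sym ordS_neq.
have adj' x y : e x y -> y = ord_pred x \/ y = ordS x.
  by case/cycle_edge_adj; [right | left].
have cover u : u \in [set k1; k2] ->
    connect e u (ordS s) -> connect e u (ord_pred s) -> False.
  move=> uK cS cP; apply: (not_dominating1 w0 k12 min_k uK) => x.
  exact: (connect_cover _ (@ordSK n) (@ord_predK n) cycle_edge_adj cycle_edge_anti
           (ordS_orbit s) es es').
have K1 : k1 \in [set k1; k2] by rewrite !inE eqxx.
have K2 : k2 \in [set k1; k2] by rewrite !inE eqxx orbT.
have [cS|cS] := boolP (connect e k1 (ordS s)); have [cP|cP] := boolP (connect e k1 (ord_pred s)).
- by case: (cover k1).
- have [A [? SA /negPf PA ?]] := separating_set w0 k12 min_k (@ordSK n) (@ord_predK n)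
    cycle_edge_adj cycle_edge_anti es es' far cS cP.
  by exists A; split; rewrite // SA PA.
- have [A [? PA /negPf SA ?]] := separating_set w0 k12 min_k (@ord_predK n) (@ordSK n)
    adj' cycle_edge_anti es' es far cP cS.
  by exists A; split; rewrite // SA PA.
- by case: (cover k2) => //;
    [case: (dominatedP w0 min_k (ordS s)) | case: (dominatedP w0 min_k (ord_pred s))];
    rewrite // ?(negPf cS) ?(negPf cP).
Qed.

End CycleNetwork.

(** * Homology *)

Section CycleHomology.
Local Open Scope ring_scope.
Variables (F : fieldType) (n : nat) (K : {set {set 'I_n}}).
Hypothesis n_gt1 : (1 < n)%N.
Hypothesis edgesK : forall v : 'I_n, [set v; ordS v] \in K.

Definition cycle_edges : n.-tuple (chain F 'I_n) :=
  [tuple edge_chain F v (ordS v) | v < n].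

Definition fundamental_cycle : chain F 'I_n := \sum_v edge_chain F v (ordS v).

Lemma boundary_boundary1 b : b \in boundaries F K 1 -> boundary F 'I_n b = 0.
Proof.
move=> bB; apply/eqP; rewrite -memv_ker; apply: (subvP _ b bB).
apply: boundaries1_le => x y z _ _ _.
rewrite memv_ker !linearD /= !boundary_edge.
by rewrite [X in X + _]addrC !subrKA subrr.
Qed.

Lemma fundamental_cycle_in : fundamental_cycle \in cycles F K 1.
Proof.
rewrite /cycles memv_cap; apply/andP; split.
  apply: memv_suml => v _; rewrite /edge_chain.
  have mem : simplex_chain F [set v; ordS v] \in chains F K 1.
    apply: memv_span; apply: image_f; rewrite inE edgesK cards2.
    by rewrite (eq_sym v) ordS_neq.
  by do 2?case: ifP => _; rewrite ?memvN ?mem0v ?mem.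
rewrite memv_ker linear_sum /=.
under eq_bigr => v _ do rewrite boundary_edge.
rewrite sumrB subr_eq0; apply/eqP/esym.
by rewrite (reindex (@ordS n)) //=; exists (@ord_pred n) => i _; rewrite ?ordSK ?ord_predK.
Qed.

Hypothesis edges_gen : forall a b, [set a; b] \in K ->
  edge_chain F a b \in (<<cycle_edges>> + boundaries F K 1)%VS.

(** Modulo boundaries [c] is a combination [l] of cycle edges, again closed; closedness forces equal
    coefficients on consecutive edges, hence on all. *)
Lemma cycles1_decomp c : c \in cycles F K 1 ->
  exists a, c - a *: fundamental_cycle \in boundaries F K 1.
Proof.
rewrite /cycles memv_cap => /andP[cK]; rewrite memv_ker => /eqP dc.
have : c \in (<<cycle_edges>> + boundaries F K 1)%VS.
  apply: subvP cK; apply/span_subvP=> _ /imageP[t + ->]; rewrite inE => /andP[tK t2].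
  have [a [b [ab tE]]] := cards2_lt (eqP t2).
  by rewrite tE -edge_chain_lt // edges_gen // -tE.
case/memv_addP=> l lE [b bB cE].
pose al v : F := coord cycle_edges v l.
have lS : l = \sum_v al v *: edge_chain F v (ordS v).
  rewrite [LHS](coord_span lE); apply: eq_bigr => v _.
  by rewrite -tnth_nth tnth_mktuple.
have dl : \sum_v al v *: (simplex_chain F [set ordS v] - simplex_chain F [set v]) = 0.
  move: dc; rewrite cE linearD /= (boundary_boundary1 bB) addr0 lS linear_sum /=.
  move=> dl; rewrite -[RHS]dl; apply: eq_bigr => v _.
  by rewrite linearZ /= boundary_edge.
(* The coefficient of the vertex [ordS v] in the boundary of [l] is [al v - al (ordS v)]. *)
have step v : al (ordS v) = al v.
  have := congr1 (fun f : chain F 'I_n => f [set ordS v]) dl.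
  rewrite sum_ffunE ffunE (eq_bigr (fun u => al u * (u == v)%:R - al u * (u == ordS v)%:R)).
    rewrite sumrB (bigD1 v) //= eqxx big1 => [|u /negPf ->]; last by rewrite mulr0.
    rewrite (bigD1 (ordS v)) //= eqxx big1 => [|u /negPf ->]; last by rewrite mulr0.
    by rewrite !addr0 !mulr1 => /subr0_eq.
  move=> u _; rewrite !ffunE /GRing.scale /= mulrBr !(inj_eq set1_inj) (can_eq (@ordSK n)).
  by rewrite !(eq_sym v) !(eq_sym (ordS v)).
pose v0 := Ordinal n_gt1.
have alE v : al v = al v0.
  have [k ->] := ordS_orbit v0 v; elim: k => //= k IH; by rewrite step.
exists (al v0); rewrite cE.
suff -> : l = al v0 *: fundamental_cycle by rewrite addrAC subrr add0r.
by rewrite lS scaler_sumr; apply: eq_bigr => v _; rewrite alE.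
Qed.

Variables (A : {set 'I_n}) (s : 'I_n).
Hypothesis sA : s \notin A.
Hypothesis crossA : (ordS s \in A) != (ord_pred s \in A).
Hypothesis sepA : forall a b, [set a; b; s] \in K -> a != s -> b != s -> (a \in A) = (b \in A).

(** Of the terms of [crossing], the edge into [s] gives 1 if [ord_pred s] is in [A], the edge out of
    [s] gives -1 if [ordS s] is. Exactly one occurs, so the value is nonzero. *)
Lemma fundamental_cycle_notin : fundamental_cycle \notin boundaries F K 1.
Proof.
apply/negP=> /(crossing_boundary sA sepA)/eqP; rewrite linear_sum /=.
under eq_bigr => v _ do rewrite crossing_edge //.
rewrite sumrB (bigD1 (ord_pred s)) //= ord_predK eqxx big1 /=; last first.
  by move=> v; rewrite -(can_eq (@ordSK n)) ord_predK => /negPf ->.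
rewrite (bigD1 s) //= eqxx big1 /= => [|v /negPf -> //].
by move: crossA; case: (_ \in A); case: (_ \in A) => //= _; rewrite !addr0 ?subr0 ?sub0r ?oppr_eq0 oner_eq0.
Qed.

Lemma homology1_dim1 : exists h : homology F K 1,
  h != 0 /\ forall h' : homology F K 1, exists a : F, h' = a *: h.
Proof.
set W := (linfun (vsval : subvs_of (cycles F K 1) -> chain F 'I_n) @^-1: boundaries F K 1)%VS.
have inW u : (u \in W) = (vsval u \in boundaries F K 1) by rewrite -memv_preim lfunE.
have zK := vsprojK fundamental_cycle_in.
exists (\pi_(quot_space W) (vsproj (cycles F K 1) fundamental_cycle))%qT; split.
  rewrite -[X in _ != X](pi_zeror : \pi_(quot_space W)%qT 0 = 0) quot_piE subr0 inW zK.
  exact: fundamental_cycle_notin.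
move=> h'; have [a ha] := cycles1_decomp (subvsP (repr h')).
exists a; rewrite -[LHS]reprK [RHS]quot_scale_pi; apply/eqP.
by rewrite quot_piE inW linearB linearZ /= zK scalerN.
Qed.

End CycleHomology.

(** * Edges of the Dowker complex modulo boundaries *)

Section DowkerCycle.
Variables (R : realType) (n : nat) (w : 'I_n -> 'I_n -> \bar R) (delta : R).
Hypotheses (n_gt1 : (1 < n)%N) (cyc : cycle_graph w).
Hypothesis delta_max : max_edge_weight w <= delta%:E.
Let d := path_completion w.

Lemma mem_dowker y (s : {set 'I_n}) : s != set0 ->
  (forall x, x \in s -> d y x <= delta%:E) -> s \in dowker w delta.
Proof.
move=> s0 sy; rewrite inE s0; apply/existsP; exists y.
by apply/forallP=> x; apply/implyP/sy.
Qed.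

Lemma edge_weight_le v : edge_weight w v <= delta%:E.
Proof. by have /bigmax_leP[_ /(_ v isT)] := delta_max. Qed.

Lemma path_completion_refl v : d v v <= delta%:E.
Proof.
have [w0 _ _] := cyc; apply: path_completion_refl_le; rewrite -lee_fin.
by apply: le_trans (edge_weight_le v); rewrite /edge_weight; case: ifP.
Qed.

(** The tail of the edge serves as centre. *)
Lemma dowker_edge v : [set v; ordS v] \in dowker w delta.
Proof.
have nz : [set v; ordS v] != set0 by apply/set0Pn; exists v; rewrite !inE eqxx.
have := edge_weight_le v; rewrite /edge_weight; case: ifP => _ le_w.
  apply: (mem_dowker (y := v)) => // x; rewrite !inE => /orP[] /eqP ->.
    exact: path_completion_refl.
  exact: le_trans (path_completion_le_edge _ _ _) le_w.
apply: (mem_dowker (y := ordS v)) => // x; rewrite !inE => /orP[] /eqP ->.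
  exact: le_trans (path_completion_le_edge _ _ _) le_w.
exact: path_completion_refl.
Qed.

Lemma dowker_edges_gen a b : [set a; b] \in dowker w delta ->
  edge_chain R a b \in (<<cycle_edges R n>> + boundaries R (dowker w delta) 1)%VS.
Proof.
set V := (_ + _)%VS; have [w0 _ _] := cyc.
have tri y u v : d y u <= delta%:E -> d y v <= delta%:E ->
    (edge_chain R y u + edge_chain R u v + edge_chain R v y)%R \in V.
  move=> yu yv; apply: (subvP (addvSr _ _)); apply: triangle_boundary.
  apply: (mem_dowker (y := y)); first by apply/set0Pn; exists y; rewrite !inE eqxx.
  by move=> x; rewrite !inE -orbA => /or3P[] /eqP -> //; apply: path_completion_refl.
have gen v : edge_chain R v (ordS v) \in V.
  apply: (subvP (addvSl _ _)); apply: memv_span; apply/mapP; exists v => //.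
  by rewrite mem_enum.
(* Induction along a path inside the ball: modulo the triangle [y], [u], [v], the edge [yv] is [yu]
   plus the cycle edge [uv], up to sign. *)
have from_center y x : d y x <= delta%:E -> edge_chain R y x \in V.
  move=> yx; case/connectP: (connect_ball w0 yx) => p pp ->.
  suff H u q : path (ball_edge w delta%:E y) u q -> d y u <= delta%:E ->
      edge_chain R y u \in V -> edge_chain R y (last u q) \in V.
    by apply: H pp _ _; [apply: path_completion_refl | rewrite edge_chainxx mem0v].
  elim: q u => [//|v q IH] u /= /andP[/andP[uv yv] qp] yu Vyu.
  apply: (IH _ qp yv).
  have Vuv : edge_chain R u v \in V.
    case: (cycle_edge_adj cyc uv) => -> //.
    by rewrite edge_chainC memvN -{2}[u]ord_predK.
  rewrite edge_chainC memvN.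
  by have := memvB (tri y u v yu yv) (memvD Vyu Vuv); rewrite addrAC subrr add0r.
(* For a common centre [y], the triangle [y], [a], [b] expresses [ab] through two edges at the
   centre. *)
rewrite inE => /andP[_ /existsP[y /forallP aby]].
have ya : d y a <= delta%:E by apply: (implyP (aby a)); rewrite !inE eqxx.
have yb : d y b <= delta%:E by apply: (implyP (aby b)); rewrite !inE eqxx orbT.
have Vby : edge_chain R b y \in V by rewrite edge_chainC memvN from_center.
have := memvB (memvB (tri y a b ya yb) Vby) (from_center y a ya).
by rewrite addrK addrAC subrr add0r.
Qed.

End DowkerCycle.

Theorem proposition17 (R : realType) (n : nat) (hn : (3 <= n)%N)
    (w : 'I_n -> 'I_n -> \bar R) (d : 'I_n -> 'I_n -> \bar R)
    (K : {set 'I_n}) (k1 k2 s1 s2 : 'I_n) (delta : R) :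
  cycle_graph w ->
  inconsistently_oriented w ->
  d = path_completion w ->
  minimal_source_dominating d K ->
  K = [set k1; k2] -> k1 != k2 ->
  [set v | sink w v] = [set s1; s2] ->
  max_edge_weight w <= delta%:E ->
  delta%:E < Order.max (Order.max (d k1 s1) (d k1 s2))
                       (Order.max (d k2 s1) (d k2 s2)) ->
  exists h : homology R (dowker w delta) 1,
    h != 0%R /\ forall h' : homology R (dowker w delta) 1,
      exists a : R, h' = (a *: h)%R.
Proof.
move=> cyc _ -> min_k KE k12 sinksE dmax; rewrite {K}KE in min_k.
have n_gt1 : (1 < n)%N by apply: leq_trans hn.
have [sink1 sink2] : sink w s1 /\ sink w s2.
  by have /setP E := sinksE; have := E s1; have := E s2; rewrite !inE !eqxx orbT.
(* A single pair at distance above [delta] suffices; [k] and [k'] are kept general so that either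
   element of the dominating set can be the far one. *)
have main k k' s : k != k' ->
    minimal_source_dominating (path_completion w) [set k; k'] -> sink w s ->
    delta%:E < path_completion w k s ->
    exists h : homology R (dowker w delta) 1,
      h != 0%R /\ forall h' : homology R (dowker w delta) 1,
        exists a : R, h' = (a *: h)%R.
  move=> kk min_kk sk far.
  have [A [sA crossA sepA]] := cycle_separating_set n_gt1 cyc kk min_kk sk far.
  apply: (homology1_dim1 n_gt1 (dowker_edge cyc dmax) _ sA crossA).
    exact: dowker_edges_gen.
  move=> a b; rewrite inE => /andP[_ /existsP[y /forallP abs]].
  by apply: (sepA y); apply: (implyP (abs _)); rewrite !inE eqxx ?orbT.
have min_k' : minimal_source_dominating (path_completion w) [set k2; k1].
  by rewrite setUC.
have k21 : k2 != k1 by rewrite eq_sym.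
by rewrite !lt_max => /orP[/orP[] | /orP[]]; [exact: main k12 _ _ | exact: main k12 _ _
  | exact: main k21 _ _ | exact: main k21 _ _].
Qed.
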